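(* Let $q = 36(5s+1)$ with $s\in\mathbb{N}$, and let $k\in\{6,7\}$. Then $M_q(k) \le q+k-3$.
   Context: Let $A=\{0,1,\dots,q-1\}$ be an alphabet with $q$ elements, regarded as an additive group (not necessarily cyclic). An $(n,q^k,d)$ code over $A$ is a subset $C\subseteq A^n$ (not necessarily linear) with $|C|=q^k$ and minimum Hamming distance $d$. It is a maximum distance separable (MDS) code if $d=n-k+1$. $M_q(k)$ denotes the maximum $n$ for which an $(n,q^k,n-k+1)$ MDS code over $A$ exists. *)

(* Defs.v *)
From mathcomp Require Import all_boot zify.
From mathcomp Require Import boolp.
From mathcomp Require classical_sets.

Set Implicit Arguments.
Unset Strict Implicit.
Unset Printing Implicit Defensive.

Definition hdist (A : finType) (n : nat) (x y : {ffun 'I_n -> A}) : nat :=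
  #|[set i | x i != y i]|.

Definition min_distance (A : finType) (n : nat)
    (C : {set {ffun 'I_n -> A}}) (d : nat) : Prop :=
  (exists x y, [/\ x \in C, y \in C, x != y & hdist x y = d]) /\
  (forall x y, x \in C -> y \in C -> x != y -> d <= hdist x y).

(* (n, q^k, d) code over A, where q = #|A| *)
Definition is_code (A : finType) (n k d : nat)
    (C : {set {ffun 'I_n -> A}}) : Prop :=
  #|C| = #|A| ^ k /\ min_distance C d.

(* The truncation in n - k is harmless: for n < k and #|A| > 1 no subset of A^n
   has #|A| ^ k elements. *)
Definition is_MDS (A : finType) (n k : nat)
    (C : {set {ffun 'I_n -> A}}) : Prop :=
  is_code k (n - k + 1) C.

(* The alphabet is {0, ..., q-1}; an additive group law on it plays no role in
   the notions above, so none is fixed. *)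
Definition MDS_exists (q k n : nat) : Prop :=
  exists C : {set {ffun 'I_n -> 'I_q}}, is_MDS k C.

Definition is_max_MDS_length (q k m : nat) : Prop :=
  MDS_exists q k m /\ forall n, MDS_exists q k n -> n <= m.

(* The M_q(k) of the literature; the default 0 is not used when q, k > 1, see
   max_MDS_lengthP. *)
Definition max_MDS_length (q k : nat) : nat :=
  classical_sets.xget 0 (is_max_MDS_length q k).

Lemma MDS_exists_full (q k : nat) : 1 < q -> 0 < k -> MDS_exists q k k.
Proof.
move=> q1 k0; exists [set: {ffun 'I_k -> 'I_q}]; split.
  by rewrite cardsT card_ffun !card_ord.
rewrite subnn add0n; split; last first.
  move=> x y _ _; rewrite card_gt0; apply: contraNneq => xy0.
  apply/eqP/ffunP => i; apply/eqP.
  by move/setP/(_ i): xy0; rewrite !inE => /negbFE.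
pose a : 'I_q := Ordinal (ltnW q1); pose b : 'I_q := Ordinal q1.
pose i0 : 'I_k := Ordinal k0.
exists [ffun=> a], [ffun i => if i == i0 then b else a].
have E : hdist [ffun=> a] [ffun i => if i == i0 then b else a] = 1.
  rewrite /hdist -(cards1 i0); apply: eq_card => i.
  by rewrite !inE !ffunE; case: (i == i0); rewrite ?eqxx.
split; rewrite ?inE //; apply/eqP => /ffunP/(_ i0).
by rewrite !ffunE eqxx => /(congr1 val).
Qed.

Lemma MDS_exists_bounded (q k n : nat) :
  1 < q -> 1 < k -> MDS_exists q k n -> n <= (q ^ k) ^ 2 * k.
Proof.
move=> q1 k1 [C [cardC [_ dC]]]; rewrite card_ord in cardC.
pose P := [set p : _ * _ | [&& p.1 \in C, p.2 \in C & p.1 != p.2]].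
have cover (i : 'I_n) : exists p, (p \in P) && (p.1 i == p.2 i).
  have : ~~ [forall x in C, forall y in C, (x i == y i) ==> (x == y)].
    apply/negP => /forallP h.
    have inj : {in C &, injective (fun x : {ffun 'I_n -> 'I_q} => x i)}.
      move=> x y xC yC exy; have /implyP/(_ xC)/forallP/(_ y) := h x.
      by move=> /implyP/(_ yC)/implyP/(_ (introT eqP exy))/eqP.
    have := max_card (mem [set x i | x : {ffun 'I_n -> 'I_q} in C]).
    by rewrite card_in_imset // card_ord cardC -{2}(expn1 q) leq_exp2l // leqNgt k1.
  rewrite negb_forall => /existsP[x]; rewrite negb_imply negb_forall.
  case/andP=> xC /existsP[y]; rewrite !negb_imply => /and3P[yC e ne].
  by exists (x, y); rewrite inE /= xC yC ne.
have -> : n = \sum_(i < n) 1 by rewrite sum1_card card_ord.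
apply: (@leq_trans (\sum_(i < n) \sum_(p in P) (p.1 i == p.2 i))).
  apply: leq_sum => i _; have [p /andP[pP e]] := cover i.
  by rewrite (bigD1 p) //= e.
rewrite exchange_big /=; apply: (@leq_trans (\sum_(p in P) k)).
  apply: leq_sum => -[x y] /=; rewrite inE => /and3P[/= xC yC ne].
  have := dC _ _ xC yC ne; rewrite /hdist.
  have := cardsC [set i | x i != y i]; rewrite card_ord.
  have -> : \sum_(i < n) (x i == y i : nat) = #|~: [set i | x i != y i]|.
    rewrite -sum1_card [RHS]big_mkcond /=; apply: eq_bigr => i _.
    by rewrite !inE negbK; case: eqP.
  by move: #|_| #|_| => u v; lia.
rewrite sum_nat_const leq_mul2r; apply/orP; right.
have sub : P \subset setX C C.
  by apply/subsetP => -[x y]; rewrite !inE => /and3P[/= -> ->].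
by rewrite (leq_trans (subset_leq_card sub)) // cardsX cardC.
Qed.

Lemma max_MDS_lengthP (q k : nat) :
  1 < q -> 1 < k -> is_max_MDS_length q k (max_MDS_length q k).
Proof.
move=> q1 k1.
suff ex : exists m, is_max_MDS_length q k m.
  exact: (@classical_sets.xgetPex nat 0 (is_max_MDS_length q k)).
have exP : exists n, `[< MDS_exists q k n >].
  by exists k; apply/asboolP; apply: MDS_exists_full => //; apply: ltnW.
have ubP n : `[< MDS_exists q k n >] -> n <= (q ^ k) ^ 2 * k.
  by move/asboolP; apply: MDS_exists_bounded.
case: (ex_maxnP exP ubP) => m /asboolP mP mM.
by exists m; split=> // n nP; apply: mM; apply/asboolP.
Qed.

(* Main.v *)
Require Import Defs.
From mathcomp Require Import all_boot.
From mathcomp Require Import zify.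

(** For [q] even, a code violating the bound would yield a Steiner system whose
number of blocks is not an integer.

If [M_q(k) > q+k-3] with [k] equal to 6 or 7, then deleting coordinates, and
for [k = 7] also fixing one symbol, gives an MDS code of length [q+4] and
dimension 6.  Every even [q] for which an MDS code of length [q+k-2] and
dimension [k >= 3] exists satisfies

    [k-1] divides ['C(q+k-3, k-2)]          ([info_sets_dvd], [MDS_dvd]);

with [k = 6] this says [5 | (q+3)(q+2)(q+1)q/24], which fails when [q] is 1
modulo 5, as it is for [q = 36(5s+1)].

The divisibility comes from a double count.  Fix a codeword [c], two positions
[i], [i'] and symbols [a], [a'] different from those of [c] there.  Let [Q] be
the set of codewords with [a] at [i] and [a'] at [i'], and [P] the set of the
other [q+k-4] positions.  A word of [Q] agrees with [c] in at most [k-1]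
positions of [P], and every [k-2] positions of [P] lie in exactly one of these
agreement sets.  So if [Y] and [X] are the sets of words of [Q] agreeing with
[c] in exactly [k-1] and exactly [k-2] positions,

    ['C(q+k-4, k-2) = (k-1)|Y| + |X|].

When [q] is even, every [k-3] positions of [P] lie in the agreement set of
exactly one word of [X], so that ['C(q+k-4, k-3) = (k-2)|X|]; adding the two
gives ['C(q+k-3, k-2) = (k-1)(|X|+|Y|)].  In other words, the agreement sets of
size [k-1], and those of size [k-2] completed by one ideal point, are the
blocks of a Steiner system [S(k-2, k-1, q+k-3)].

The uniqueness just used ([card_tangent]) is the coding form of the fact that
the tangents of an oval in a plane of even order are concurrent.  Fixing the
[k-3] positions and the symbol at [i] leaves a code of dimension 2 on [q]
positions, each word of which agrees with [c] at most twice.  For each position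
there is exactly one word agreeing with [c] only there ([card_tangent_at]);
leaving out [i'], this makes [q-1] such tangents, to be shared among the [q-1]
possible symbols at [i'].  Each symbol receives an odd number of tangents,
because its words meet [c] a total of [q-1] times ([odd_tangents]).  Hence each
receives exactly one. *)

Set Implicit Arguments.
Unset Strict Implicit.
Unset Printing Implicit Defensive.

(** * Information sets and agreement sets *)

Section Codes.

Variables (I A : finType).
Implicit Types (U S T V : {set I}) (C D X : {set {ffun I -> A}}).
Implicit Types (x y c w : {ffun I -> A}).

Definition agr x y : {set I} := [set i | x i == y i].

Definition pin X S w := [set x in X | S \subset agr x w].

(** The MDS property in positional form, relative to a set [U] of positions: any
[k] positions of [U] determine a codeword, and their symbols are arbitrary.  It
restricts to smaller sets of positions by definition, so that coordinates never
have to be deleted from the words. *)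
Definition info_sets U k C :=
  forall S w, S \subset U -> #|S| = k -> #|pin C S w| = 1.

Lemma exists_subset_card U m : m <= #|U| -> exists2 S : {set I}, S \subset U & #|S| = m.
Proof.
rewrite -bin_gt0 -(cards_draws U m) card_gt0 => /set0Pn[S].
by rewrite inE => /andP[SU /eqP Sm]; exists S.
Qed.

Lemma info_sets_subset U V k C :
  V \subset U -> info_sets U k C -> info_sets V k C.
Proof. by move=> VU infC S w SV; apply: infC; apply: subset_trans VU. Qed.

(** Shortening: the positions of [T] are kept in the words but leave the set of
positions under consideration. *)
Lemma info_sets_pin U T k C w :
  T \subset U -> info_sets U (#|T| + k) C -> info_sets (U :\: T) k (pin C T w).
Proof.
move=> TU infC S v SUT Sk.
have dST : [disjoint T & S].
  rewrite disjoint_sym disjoints_subset; apply: subset_trans SUT _.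
  by rewrite setDE subsetIr.
(* one word prescribing both the symbols on T and those on S *)
pose u := [ffun j => if j \in T then w j else v j].
rewrite -(infC (T :|: S) u).
- apply: eq_card => x; rewrite !inE -andbA subUset; congr [&& _, _ & _].
    by apply/subsetP/subsetP => h j jT; have := h j jT; rewrite !inE ffunE jT.
  by apply/subsetP/subsetP => h j jS; have := h j jS;
    rewrite !inE ffunE (disjointFl dST jS).
- by rewrite subUset TU (subset_trans SUT) ?subsetDl.
- by rewrite cardsU (disjoint_setI0 dST) cards0 subn0 Sk.
Qed.

Lemma card_agr_lt U k C x c : info_sets U k C ->
  x \in C -> c \in C -> x != c -> #|U :&: agr x c| < k.
Proof.
move=> infC xC cC; apply: contraR; rewrite -leqNgt => /exists_subset_card[S].
rewrite subsetI => /andP[SU Sagr] /(infC S c SU)/eqP/cards1P[y pinE].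
have: x \in pin C S c by rewrite inE xC.
have: c \in pin C S c.
  by rewrite inE cC; apply/subsetP=> j _; rewrite inE.
by rewrite pinE !inE => /eqP-> /eqP->.
Qed.

(** Incidences between the words of [X] and the [m]-sets of positions on which
they agree with [c], counted in two ways. *)
Lemma sum_bin_agr U X c m :
  \sum_(x in X) 'C(#|U :&: agr x c|, m) =
  \sum_(T : {set I} | (T \subset U) && (#|T| == m)) #|pin X T c|.
Proof.
under [RHS]eq_bigr do rewrite -sum1_card.
rewrite (exchange_big_dep (fun x => x \in X)) /=; last first.
  by move=> T x _; rewrite inE => /andP[].
apply: eq_bigr => x xX; rewrite sum1_card -(cards_draws _ m).
apply: eq_card => T; rewrite !inE subsetI.
by rewrite unfold_in /= inE xX andbAC.
Qed.

Lemma sum_bin_agr_regular U X c m :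
  (forall T, T \subset U -> #|T| = m -> #|pin X T c| = 1) ->
  \sum_(x in X) 'C(#|U :&: agr x c|, m) = 'C(#|U|, m).
Proof.
move=> X1; rewrite sum_bin_agr -(cards_draws U m) -sum1_card.
apply: eq_big => T; first by rewrite inE.
by move=> /andP[TU /eqP]; apply: X1.
Qed.

Lemma card_info_sets1 U C l : info_sets U 1 C -> l \in U -> #|C| = #|A|.
Proof.
move=> infC lU; rewrite -[LHS]sum1_card.
rewrite (partition_big (fun x : {ffun I -> A} => x l) predT) //=.
rewrite -sum1_card; apply: eq_bigr => a _.
rewrite sum1_card -[RHS](infC [set l] [ffun=> a]) ?sub1set ?cards1 //.
by apply: eq_card => x; rewrite unfold_in /= !inE sub1set inE ffunE.
Qed.

(** * Tangents of a code of dimension 2 *)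

Lemma eq1_of_sum_card (T : finType) (P : pred T) (F : T -> nat) :
  (forall a, P a -> 0 < F a) -> \sum_(a | P a) F a = #|P| ->
  forall a, P a -> F a = 1.
Proof.
move=> F0; rewrite -sum1_card => E a Pa.
have le b : P b -> 1 <= F b ?= iff (F b == 1).
  by move=> Pb; split; [exact: F0 | rewrite eq_sym].
have := (leqif_sum le).2; rewrite E eqxx => /esym/forall_inP/(_ a Pa).
by move/eqP.
Qed.

(** [D] plays a net with [#|A|] parallel classes: its words are the points, and a
position with a symbol is a line.  The word [c], which need not lie in [D], is
the trace of the oval: one line in each class, with at most two of them through
a point; the words agreeing with [c] exactly once are called tangents. *)
Section Tangents.

Variables (V : {set I}) (D : {set {ffun I -> A}}) (c : {ffun I -> A}).
Hypothesis infD : info_sets V 2 D.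
Hypothesis cardV : #|V| = #|A|.
Hypothesis agr2 : forall x, x \in D -> #|V :&: agr x c| <= 2.

(** There are [#|A|] words agreeing with [c] at [j].  Each of the other [#|A| - 1]
positions provides one among them agreeing with [c] there as well, and these
are distinct, since three agreements are impossible.  One word remains. *)
Lemma card_tangent_at i j : i \in V -> j \in V -> i != j ->
  #|[set x in D | V :&: agr x c == [set j]]| = 1.
Proof.
move=> iV jV ij.
pose Z := pin D [set j] c.
have infZ : info_sets (V :\ j) 1 Z.
  by apply: info_sets_pin; rewrite ?sub1set ?cards1.
have cardZ : #|Z| = #|A|.
  by apply: (card_info_sets1 (l := i) infZ); rewrite !inE ij.
have agrZ x : x \in Z -> #|V :&: agr x c| = (#|(V :\ j) :&: agr x c|).+1.
  rewrite inE sub1set inE => /andP[_ xj].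
  by rewrite (cardsD1 j) in_setI jV inE xj -setIDAC add1n.
have sumZ : \sum_(x in Z) #|(V :\ j) :&: agr x c| = #|A|.-1.
  transitivity 'C(#|V :\ j|, 1).
    rewrite -(sum_bin_agr_regular (X := Z) (c := c)).
      by apply: eq_bigr => x _; rewrite bin1.
    by move=> T TV T1; apply: infZ.
  by rewrite bin1 -cardV (cardsD1 j V) jV.
(* the second term counts the tangents: each word of Z contributes 1 in all *)
have: \sum_(x in Z) (#|(V :\ j) :&: agr x c| +
                     (#|(V :\ j) :&: agr x c| == 0)) = #|A|.
  rewrite -cardZ -sum1_card; apply: eq_bigr => x xZ.
  have xD : x \in D by move: xZ; rewrite inE => /andP[].
  by have := agr2 xD; rewrite (agrZ x xZ); case: #|_| => [|[]].
rewrite big_split /= sumZ -big_mkcondr sum1_card.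
have -> : #|[pred x in Z | #|(V :\ j) :&: agr x c| == 0]| =
          #|[set x in D | V :&: agr x c == [set j]]|.
  apply: eq_card => x; rewrite !inE sub1set inE -andbA; congr (_ && _).
  rewrite setIDAC cards_eq0 setD_eq0; apply/andP/eqP => [[xj sub]|E].
    apply/eqP; rewrite eqEsubset sub sub1set !inE jV; exact: xj.
  by have := set11 j; rewrite -E !inE => /andP[_ ->].
have : 0 < #|A| by rewrite -cardV; apply/card_gt0P; exists j.
by case: #|A| => // n _; rewrite -[in RHS]addn1 => /addnI.
Qed.

(** The words with symbol [a] at [i] agree with [c] once at every position other
than [i], in total an odd number [#|A| - 1] of times; modulo 2, only the words
agreeing exactly once matter. *)
Lemma odd_tangents i a : ~~ odd #|A| -> i \in V -> a != c i ->
  odd #|[set x in D | (x i == a) && (#|V :&: agr x c| == 1)]|.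
Proof.
move=> evA iV ai.
pose w : {ffun I -> A} := [ffun=> a].
pose Q := pin D [set i] w.
have infQ : info_sets (V :\ i) 1 Q.
  by apply: info_sets_pin; rewrite ?sub1set ?cards1.
have agrQ x : x \in Q -> (V :\ i) :&: agr x c = V :&: agr x c.
  rewrite inE sub1set inE ffunE => /andP[_ /eqP xi].
  rewrite setIDAC; apply/setDidPl.
  by rewrite disjoint_sym disjoints1 !inE xi (negPf ai) andbF.
have sumQ : \sum_(x in Q) #|V :&: agr x c| = #|A|.-1.
  transitivity 'C(#|V :\ i|, 1).
    rewrite -(sum_bin_agr_regular (X := Q) (c := c)).
      by apply: eq_bigr => x xQ; rewrite bin1 agrQ.
    by move=> T TV T1; apply: infQ.
  by rewrite bin1 -cardV (cardsD1 i V) iV.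
have odd1 : odd #|A|.-1.
  have : 0 < #|A| by apply/card_gt0P; exists a.
  by case: #|A| evA => //= n; rewrite negbK.
suff -> : odd #|[set x in D | (x i == a) && (#|V :&: agr x c| == 1)]| =
          odd (\sum_(x in Q) #|V :&: agr x c|) by rewrite sumQ.
rewrite -sum1_card.
rewrite (eq_bigl (fun x => (x \in Q) && (#|V :&: agr x c| == 1))); last first.
  by move=> x; rewrite !inE sub1set inE ffunE -andbA.
rewrite big_mkcondr !(big_morph odd oddD (erefl _)).
apply: eq_bigr => x; rewrite inE => /andP[xD _].
by have := agr2 xD; case: #|_| => [|[|[]]].
Qed.

(** The tangents differing from [c] at [i] number one for each position other
than [i], that is [#|A| - 1]; and each of the [#|A| - 1] symbols other than
[c i] is taken at [i] by at least one of them, by parity. *)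
Lemma card_tangent i a : ~~ odd #|A| -> i \in V -> a != c i ->
  #|[set x in D | (x i == a) && (#|V :&: agr x c| == 1)]| = 1.
Proof.
move=> evA iV.
pose F b := #|[set x in D | (x i == b) && (#|V :&: agr x c| == 1)]|.
apply: (@eq1_of_sum_card A [pred b | b != c i] F) => [b bi|].
  by apply: odd_gt0; apply: odd_tangents.
pose N := [set x in D | (x i != c i) && (#|V :&: agr x c| == 1)].
transitivity #|N|.
  rewrite -[RHS]sum1_card.
  rewrite (partition_big (fun x : {ffun I -> A} => x i) [pred b | b != c i]).
    apply: eq_bigr => b /= bi; rewrite sum1_card; apply: eq_card => x.
    rewrite [RHS]unfold_in /= !inE; case: (x \in D) => //=.
    by rewrite [RHS]andbC; case: (eqVneq (x i) b) => [->|] //=; rewrite bi.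
  by move=> x /=; rewrite inE => /and3P[].
transitivity (\sum_(j in V :\ i) 1); last first.
  rewrite sum1_card; apply: (@addnI 1).
  transitivity #|V|; first by rewrite (cardsD1 i V) iV.
  by rewrite cardV -(cardC (pred1 (c i))) card1.
transitivity (\sum_(j in V :\ i) #|[set x in D | V :&: agr x c == [set j]]|).
  under eq_bigr do rewrite -sum1_card.
  rewrite (exchange_big_dep (fun x => x \in N)) /=.
    rewrite -[LHS]sum1_card; apply: eq_bigr => x.
    rewrite inE => /and3P[xD xi /cards1P[j E]].
    have jN : j \in V :\ i.
      have := set11 j; rewrite -E !inE => /andP[-> xj]; rewrite andbT.
      by apply: contra xi => /eqP <-.
    rewrite (big_pred1 j) // => l; rewrite [x \in _]inE xD E /=.
    apply/andP/eqP => [[_ /eqP/set1_inj]|->] //.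
  move=> j x; rewrite !inE => /andP[ji _] /andP[-> /eqP E].
  rewrite E cards1 eqxx andbT /=.
  have := in_set1 i j; rewrite -E !inE iV /= => ->.
  by rewrite eq_sym.
apply: eq_bigr => j; rewrite !inE => /andP[ji jV].
by apply: (@card_tangent_at i) => //; rewrite eq_sym.
Qed.

End Tangents.

(** * The divisibility condition *)

(** The dimension is [t+3], so the blocks have size [t+2] and any [t+1] of the
[#|A| + t] points of the Steiner system lie in one block. *)
Theorem info_sets_dvd t U C :
  1 < #|A| -> ~~ odd #|A| -> #|U| = #|A| + t.+1 -> info_sets U t.+3 C ->
  t.+2 %| 'C(#|A| + t, t.+1).
Proof.
move=> A1 evA cardU infC.
have [a0 [a1 [_ _ a01]]] := card_gt1P A1.
have [S0 S0U S0k] : exists2 S : {set I}, S \subset U & #|S| = t.+3.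
  by apply: exists_subset_card; rewrite cardU; lia.
have [c cC] : exists c, c \in C.
  have /eqP/cards1P[c E] := infC S0 [ffun=> a0] S0U S0k.
  by exists c; have := set11 c; rewrite -E inE => /andP[].
have other b : exists a : A, a != b.
  by case: (eqVneq a0 b) => [<-|]; [exists a1; rewrite eq_sym | exists a0].
have [i [i' [iU i'U ii']]] : exists i i', [/\ i \in U, i' \in U & i != i'].
  by apply/card_gt1P; rewrite cardU; lia.
have [a ai] := other (c i); have [a' ai'] := other (c i').
pose w : {ffun I -> A} :=
  [ffun j => if j == i then a else if j == i' then a' else c j].
have wi : w i = a by rewrite ffunE eqxx.
have wi' : w i' = a' by rewrite ffunE eq_sym (negPf ii') eqxx.
pose E := [set i; i'].
have cardE : #|E| = 2 by rewrite cards2 ii'.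
have EU : E \subset U by rewrite subUset !sub1set iU.
pose P := U :\: E.
have cardP : #|P| = #|A| + t - 1 by rewrite cardsDS // cardE cardU; lia.
pose Q := pin C E w.
have infQ : info_sets P t.+1 Q.
  by apply: info_sets_pin => //; rewrite cardE.
have QE x : (x \in Q) = [&& x \in C, x i == a & x i' == a'].
  by rewrite inE subUset !sub1set !inE wi wi'.
have agrP x : x i != c i -> x i' != c i' -> P :&: agr x c = U :&: agr x c.
  move=> xi xi'; rewrite setIDAC; apply/setDidPl.
  rewrite disjoint_sym /E disjoints_subset subUset !sub1set !inE.
  by rewrite (negPf xi) (negPf xi') !andbF.
have agrC x : x \in C -> x i != c i -> #|U :&: agr x c| <= t.+2.
  move=> xC xi; rewrite -ltnS; apply: (card_agr_lt infC) => //.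
  by apply: contraNneq xi => ->.
(* the blocks through the ideal point, each lacking that point *)
pose X := [set x in Q | #|P :&: agr x c| == t.+1].
have sumX : t.+1 * #|X| = 'C(#|P|, t).
  rewrite -(sum_bin_agr_regular (X := X) (c := c)).
    rewrite mulnC -sum_nat_const; apply: eq_bigr => x.
    by rewrite inE => /andP[_ /eqP->]; rewrite binSn.
  move=> T TP Tt.
  (* Pinning i to a and T to the symbols of c leaves dimension 2, and the words
     of X containing T become the tangents with symbol a' at i'. *)
  have iT : i \notin T by apply/negP => /(subsetP TP); rewrite !inE eqxx.
  have i'T : i' \notin T.
    by apply/negP => /(subsetP TP); rewrite !inE eqxx orbT.
  have TU : T \subset U by apply: subset_trans TP _; apply: subsetDl.
  have iTU : i |: T \subset U by rewrite subUset sub1set iU.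
  pose V := U :\: (i |: T); pose D := pin C (i |: T) w.
  have wT j : j \in T -> w j = c j.
    move=> jT; rewrite ffunE; case: eqP => [ji|_]; first by rewrite -ji jT in iT.
    by case: eqP => [ji|//]; rewrite -ji jT in i'T.
  have cardV : #|V| = #|A|.
    by rewrite cardsDS // cardsU1 iT cardU Tt add1n addnK.
  have infD : info_sets V 2 D.
    by apply: info_sets_pin => //; rewrite cardsU1 iT Tt add1n addn2.
  have DE x : (x \in D) = [&& x \in C, x i == a & T \subset agr x c].
    rewrite inE subUset sub1set inE wi; congr [&& _, _ & _].
    by apply/subsetP/subsetP => h j jT; have := h j jT; rewrite !inE wT.
  have agrV x : x i == a -> T \subset agr x c ->
      #|U :&: agr x c| = t + #|V :&: agr x c|.
    move=> /eqP xi Tx; rewrite -Tt -(cardsID T (U :&: agr x c)).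
    have -> : U :&: agr x c :&: T = T by apply/setIidPr; rewrite subsetI TU.
    congr (_ + _); apply: eq_card => j; rewrite !inE.
    case: (eqVneq j i) => [->|_] /=; first by rewrite xi (negPf ai) !andbF.
    by rewrite andbA.
  have agrD x : x \in D -> #|V :&: agr x c| <= 2.
    rewrite DE => /and3P[xC xi Tx].
    have := agrC x xC; rewrite (eqP xi) (agrV x) // => /(_ ai).
    by rewrite -addn2 leq_add2l.
  have i'V : i' \in V by rewrite !inE eq_sym (negPf ii') (negPf i'T) i'U.
  rewrite -(card_tangent infD cardV agrD evA i'V ai').
  apply: eq_card => x; rewrite [in RHS]inE DE inE [x \in X]inE QE.
  case: (x \in C) => //=; case: (eqVneq (x i) a) => //= xi.
  rewrite [RHS]andbCA [LHS]andbC; case: (boolP (T \subset _)) => Tx; last first.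
    by rewrite andbF.
  case: (eqVneq (x i') a') => //= xi'.
  rewrite agrP ?xi ?xi' // agrV ?xi //.
  by rewrite -addn1 eqn_add2l.
pose Y := [set x in Q | #|P :&: agr x c| == t.+2].
have sumQ : 'C(#|P|, t.+1) = #|X| + t.+2 * #|Y|.
  rewrite -(sum_bin_agr_regular (X := Q) (c := c)); last first.
    by move=> T TP Tt; apply: infQ.
  rewrite -!sum1dep_card big_distrr /= !big_mkcondr -big_split /=.
  apply: eq_bigr => x; rewrite QE => /and3P[xC /eqP xi /eqP xi'].
  have := agrC x xC; rewrite agrP ?xi ?xi' // => /(_ ai).
  rewrite leq_eqVlt => /predU1P[->|].
    by rewrite binSn eqxx muln1 (gtn_eqF (ltnSn _)).
  rewrite ltnS leq_eqVlt => /predU1P[->|lt].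
    by rewrite binn eqxx (ltn_eqF (ltnSn _)).
  by rewrite bin_small // !ltn_eqF // ltnS ltnW.
have -> : #|A| + t = #|P|.+1 by rewrite cardP; lia.
by rewrite binS sumQ -sumX addnAC -mulSn -mulnDr dvdn_mulr.
Qed.

End Codes.

(** Codewords agreeing on [k] positions are at distance at most [n - k], hence
equal: the projection to these positions is injective, and bijective because
both sides have [#|A| ^ k] elements. *)
Lemma info_sets_MDS (A : finType) (n k : nat) (C : {set {ffun 'I_n -> A}}) :
  k <= n -> is_MDS k C -> info_sets setT k C.
Proof.
move=> kn [cardC [_ dC]] S w _ Sk.
pose restr (x : {ffun 'I_n -> A}) : {ffun {j | j \in S} -> A} :=
  [ffun j => x (val j)].
have restrE x y : restr x = restr y <-> S \subset agr x y.
  split=> [/ffunP E|/subsetP sub].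
    apply/subsetP => j jS; have := E (exist _ j jS).
    by rewrite !ffunE inE /= => ->.
  apply/ffunP => -[j jS]; rewrite !ffunE /=.
  by have := sub j jS; rewrite inE => /eqP.
have inj : {in C &, injective restr}.
  move=> x y xC yC /restrE sub; apply/eqP; apply: contraT => ne.
  have := dC x y xC yC ne; rewrite /hdist.
  have <- : ~: agr x y = [set j | x j != y j] by apply/setP => j; rewrite !inE.
  have := subset_leq_card sub; rewrite Sk => le.
  by rewrite cardsCs setCK card_ord; lia.
have surj : restr @: C = setT.
  apply/eqP; rewrite eqEcard subsetT cardsT card_in_imset //.
  rewrite cardC card_ffun card_sig -Sk; apply/eq_leq.
  by congr (_ ^ _); apply: eq_card.
have /imsetP[x xC wx] : restr w \in restr @: C by rewrite surj inE.
rewrite -(cards1 x); apply: eq_card => y; rewrite !inE.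
apply/andP/eqP => [[yC /restrE yw]|->].
  by apply: inj => //; rewrite yw.
by split=> //; apply/restrE.
Qed.

(** Longer codes and larger dimensions reduce to length [q+t+1] and dimension
[t+3] by ignoring positions and by fixing the symbols of [k-t-3] of them. *)
Theorem MDS_dvd (q k n t : nat) :
  1 < q -> ~~ odd q -> t.+3 <= k -> q + k - 2 <= n -> MDS_exists q k n ->
  t.+2 %| 'C(q + t, t.+1).
Proof.
move=> q1 evq tk kn [C mdsC].
have infC : info_sets setT k C by apply: info_sets_MDS mdsC; lia.
have [w] : exists w : {ffun 'I_n -> 'I_q}, true.
  by exists [ffun=> Ordinal (ltnW q1)].
have [T _ Tk] : exists2 T : {set 'I_n}, T \subset setT & #|T| = k - t.+3.
  by apply: exists_subset_card; rewrite cardsT card_ord; lia.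
have [U UT Uk] : exists2 U : {set 'I_n}, U \subset setT :\: T & #|U| = q + t.+1.
  by apply: exists_subset_card; rewrite cardsDS // cardsT card_ord Tk; lia.
have infU : info_sets U t.+3 (pin C T w).
  by apply: info_sets_subset UT _; apply: info_sets_pin => //; rewrite Tk subnK.
by have := info_sets_dvd _ _ _ infU; rewrite card_ord => /(_ q1 evq Uk).
Qed.

Theorem corollary2p3p1 (q s k : nat) (hq : q = 36 * (5 * s + 1))
    (hk : k = 6 \/ k = 7) :
  max_MDS_length q k <= q + k - 3.
Proof.
have q1 : 1 < q by lia.
have k1 : 1 < k by lia.
have [exC _] := max_MDS_lengthP q1 k1.
rewrite leqNgt; apply/negP => lt.
have : 5 %| 'C(q + 3, 4) by apply: (MDS_dvd (t := 3)) exC; lia.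
(* the falling factorial (q+3)(q+2)(q+1)q is 4! modulo 5 *)
move/(dvdn_mulr 4`!); rewrite bin_ffact.
have -> : (q + 3) ^_ 4 = (q + 3) * ((q + 2) * ((q + 1) * q)).
  by rewrite addn3 !ffactSS ffactn1 addn2 addn1.
have -> : q = 5 * (36 * s + 7) + 1 by lia.
rewrite !Euclid_dvdM //; lia.
Qed.
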